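(* Let $0<p<1$ and let $L(n)$ be the length of the longest success run in the first $n$ of a sequence of i.i.d. Bernoulli($p$) trials. Define $$\widetilde{\Lambda}^*(x)=\begin{cases}+\infty, & x<0,\\ x\ln(1/p), & 0\le x\le 1,\\ +\infty, & x>1.\end{cases}$$ Then $L(n)/n$ satisfies a large deviation principle with good rate function $\widetilde{\Lambda}^*$ and speed $n$. Namely: (i) for any open set $O\subset\mathbb{R}$, $$\liminf_{n\to\infty}\frac{1}{n}\ln\mathbb{P}\left(\frac{L(n)}{n}\in O\right)\ge -\inf_{x\in O}\widetilde{\Lambda}^*(x);$$ (ii) for any closed set $F\subset\mathbb{R}$, $$\limsup_{n\to\infty}\frac{1}{n}\ln\mathbb{P}\left(\frac{L(n)}{n}\in F\right)\le -\inf_{x\in F}\widetilde{\Lambda}^*(x).$$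
   Context: $X_1,X_2,\ldots$ are i.i.d. with $\mathbb{P}(X_i=1)=p$, $\mathbb{P}(X_i=0)=1-p$. For $n\ge 1$, $L(n)$ is the largest integer $\ell\ge 0$ such that $X_{i+1}+\cdots+X_{i+\ell}=\ell$ for some $0\le i\le n-\ell$. $\ln$ is the natural logarithm. A good rate function is a lower semicontinuous function with values in $[0,\infty]$ whose sublevel sets $\{x:\widetilde\Lambda^*(x)\le c\}$, $c\ge 0$, are compact. Conventions: $\ln 0=-\infty$, $\inf\emptyset=+\infty$. *)

(* Defs.v *)
From HB Require Import structures.
From mathcomp Require Import all_boot all_order all_algebra finmap.
From mathcomp Require Import all_classical all_reals all_analysis.

Set Implicit Arguments.
Unset Strict Implicit.
Unset Printing Implicit Defensive.

Import Order.TTheory GRing.Theory Num.Theory.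
Import numFieldNormedType.Exports.

Local Open Scope classical_set_scope.
Local Open Scope ring_scope.

(* Sequences of trials are indexed from 0: [X j] is the (j + 1)-st trial. *)

Definition mutually_independent {d} {T : measurableType d} {R : realType}
    (P : probability T R) (X : nat -> {RV P >-> R}) : Prop :=
  forall (J : {fset nat}) (B : nat -> set R),
    (forall j, measurable (B j)) ->
    P (\bigcap_(j in [set` J]) (X j @^-1` B j)) =
      (\prod_(j <- J) P (X j @^-1` B j))%E.

Definition iid_bernoulli {d} {T : measurableType d} {R : realType}
    (P : probability T R) (p : R) (X : nat -> {RV P >-> R}) : Prop :=
  (forall j, P [set w | X j w = 1] = p%:E /\ P [set w | X j w = 0] = (1 - p)%:E)
  /\ mutually_independent X.

(* The condition [0 <= i <= n - l] over the integers is [i + l <= n] over nat;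
   it forces [i <= n] and [l <= n], whence the finite ranges.
   The empty run [l = 0] always qualifies. *)
Definition longest_run {R : pzRingType} (x : nat -> R) (n : nat) : nat :=
  \max_(l < n.+1 | [exists i : 'I_n.+1,
      (i + l <= n)%N && (\sum_(k < l) x (i + k)%N == l%:R)]) l.

Definition good_rate_function {R : realType} (I : R -> \bar R) : Prop :=
  [/\ forall x, (0 <= I x)%E,
      lower_semicontinuous I &
      forall c : R, 0 <= c -> compact [set x | (I x <= c%:E)%E]].

Definition run_rate {R : realType} (p x : R) : \bar R :=
  if x < 0 then +oo%E
  else if x <= 1 then (x * ln (1 / p))%:E
  else +oo%E.

(* Main.v *)
(* The probability that a given block of l consecutive trials is a success run
   is p^l = exp(-l ln(1/p)), and there are at most (n+1)^2 blocks in the first n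
   trials.  The union bound therefore gives, for any set A,
   P(L(n)/n in A) <= (n+1)^2 exp(-n inf_A rate), which is the upper bound.  For
   the lower bound near x in [0, 1], the first l = floor(nx) trials all succeed
   with probability p^l >= exp(-n x ln(1/p)), which forces L(n) >= l, while by
   the union bound the event L(n) >= n(x + r) is exponentially less likely; so
   |L(n)/n - x| < r with probability at least exp(-n x ln(1/p)) / 2 for large
   n. *)
Require Import Defs.
From HB Require Import structures.
From mathcomp Require Import all_boot all_order all_algebra finmap.
From mathcomp Require Import all_classical all_reals all_analysis.
From mathcomp Require Import lra.

Set Implicit Arguments.
Unset Strict Implicit.
Unset Printing Implicit Defensive.

Import Order.TTheory GRing.Theory Num.Theory.
Import numFieldNormedType.Exports.

Local Open Scope classical_set_scope.
Local Open Scope ring_scope.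

(** * Eventual bounds on limits superior and inferior *)

Lemma limn_esup_le (R : realType) (u : nat -> \bar R) (l : \bar R) :
  (\forall n \near \oo, (u n <= l)%E) -> (limn_esup u <= l)%E.
Proof.
(* The limit superior is an infimum of suprema over the sets of the filter; the set where the bound
   holds is one of them. *)
move=> ul; apply: (@ge_ereal_inf _ _ l).
exists (ereal_sup (u @` [set n | (u n <= l)%E])).
  by exists [set n | (u n <= l)%E].
by apply: ge_ereal_sup => _ [n ? <-].
Qed.

Lemma le_limn_einf (R : realType) (u : nat -> \bar R) (l : \bar R) :
  (\forall n \near \oo, (l <= u n)%E) -> (l <= limn_einf u)%E.
Proof.
move=> lu; rewrite leeNr; apply: limn_esup_le.
by apply: filterS lu => n lun; rewrite leeN2.
Qed.

(** * The longest run: attainment and measurability *)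

Lemma longest_run_witness (R : pzRingType) (x : nat -> R) n :
  exists2 i, (i + longest_run x n <= n)%N &
    \sum_(k < longest_run x n) x (i + k)%N = (longest_run x n)%:R.
Proof.
rewrite /longest_run.
pose Q (l : 'I_n.+1) := [exists i : 'I_n.+1,
  (i + l <= n)%N && (\sum_(k < l) x (i + k)%N == l%:R)].
(* The empty run keeps the set of lengths nonempty, so the maximum is attained. *)
have Q0 : (0 < #|Q|)%N.
  apply/card_gt0P; exists ord0; rewrite unfold_in; apply/existsP; exists ord0.
  by rewrite /= big_ord0 eqxx.
have [l + El] := eq_bigmax_cond (@nat_of_ord n.+1) Q0.
rewrite (_ : \max_(_ < _ | _) _ = l); last exact: El.
by rewrite unfold_in => /existsP[i /andP[iln /eqP sl]]; exists i.
Qed.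

Lemma leq_longest_run (R : pzRingType) (x : nat -> R) n i l :
  (i + l <= n)%N -> \sum_(k < l) x (i + k)%N = l%:R -> (l <= longest_run x n)%N.
Proof.
move=> iln sl.
have ln : (l < n.+1)%N by rewrite ltnS (leq_trans _ iln)// leq_addl.
have iln' : (i < n.+1)%N by rewrite ltnS (leq_trans _ iln)// leq_addr.
apply: (@leq_bigmax_cond _ _ (@nat_of_ord n.+1) (Ordinal ln)).
by apply/existsP; exists (Ordinal iln'); rewrite /= iln sl eqxx.
Qed.

Lemma longest_run_leq (R : pzRingType) (x : nat -> R) n : (longest_run x n <= n)%N.
Proof.
by have [i iln _] := longest_run_witness x n; rewrite (leq_trans _ iln)// leq_addl.
Qed.

Lemma measurable_run d (T : measurableType d) (R : realType)
    (P : probability T R) (X : nat -> {RV P >-> R}) i l :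
  measurable [set w | \sum_(k < l) X (i + k)%N w = l%:R].
Proof.
have mf : measurable_fun setT (fun w => \sum_(k < l) X (i + k)%N w).
  by apply: measurable_sum => k; exact: measurable_funP.
by have := mf measurableT [set l%:R] (measurable_set1 _); rewrite setTI.
Qed.

(** Each tail event, that the longest run has length at least [l], is a countable union of run
    events. Level sets are differences of consecutive tails, and [A] is a countable union of
    levels. *)
Lemma measurable_longest_run d (T : measurableType d) (R : realType)
    (P : probability T R) (X : nat -> {RV P >-> R}) n (A : set nat) :
  measurable [set w | A (longest_run (fun j => X j w) n)].
Proof.
have mge l : measurable [set w | (l <= longest_run (fun j => X j w) n)%N].
  rewrite (_ : mkset _ = \bigcup_(k in [set k | (l <= k)%N])
      \bigcup_(i in [set i | (i + k <= n)%N])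
      [set w | \sum_(j < k) X (i + j)%N w = k%:R]).
    apply: bigcup_measurable => k _; apply: bigcup_measurable => i _.
    exact: measurable_run.
  apply/seteqP; split=> w /=.
    move=> lL; have [i iL sL] := longest_run_witness (fun j => X j w) n.
    by exists (longest_run (fun j => X j w) n) => //; exists i.
  move=> [k /= lk [i /= ikn sk]]; rewrite (leq_trans lk)//.
  exact: leq_longest_run sk.
rewrite (_ : mkset _ = \bigcup_(l in A)
    ([set w | (l <= longest_run (fun j => X j w) n)%N] `\`
     [set w | (l.+1 <= longest_run (fun j => X j w) n)%N])).
  by apply: bigcup_measurable => l _; exact: measurableD.
apply/seteqP; split=> w /=.
  by move=> Aw; exists (longest_run (fun j => X j w) n) => //=; rewrite leqnn ltnn.
move=> [l Al /= [lL /negP]]; rewrite -leqNgt => Ll.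
by rewrite (_ : longest_run _ _ = l)//; apply/eqP; rewrite eqn_leq Ll.
Qed.

(** * Probabilities of runs and the union bound *)

Lemma prob_all_ones d (T : measurableType d) (R : realType)
    (P : probability T R) (p : R) (X : nat -> {RV P >-> R}) (J : {fset nat}) :
  iid_bernoulli p X ->
  P (\bigcap_(j in [set` J]) X j @^-1` [set 1]) = (p ^+ #|` J|)%:E.
Proof.
move=> [X01 indX]; rewrite (indX J (fun=> [set 1])) //.
rewrite (eq_bigr (fun=> p%:E)) => [|j _]; last exact: (X01 j).1.
by rewrite prodEFin big_const_seq count_predT iter_mulr_1.
Qed.

(* A Bernoulli variable may take values outside {0, 1} on a null set, where a
   block could sum to its length without being all ones. *)
Lemma negligible_not_binary d (T : measurableType d) (R : realType)
    (P : probability T R) (p : R) (X : nat -> {RV P >-> R}) :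
  iid_bernoulli p X ->
  P.-negligible (\bigcup_j ~` (X j @^-1` [set 0] `|` X j @^-1` [set 1])).
Proof.
move=> [X01 _]; apply: negligible_bigcup => j.
have mX (r : R) : measurable (X j @^-1` [set r]).
  by rewrite -[X in measurable X]setTI; exact: measurable_funP.
apply/negligibleP; first by apply: measurableC; exact: measurableU.
apply: eq_trans (probability_setC P _) _; first exact: measurableU.
have P1 : P (X j @^-1` [set 0] `|` X j @^-1` [set 1]) = 1%E.
  rewrite measureU//; last first.
    by apply/seteqP; split=> // w /= [-> /eqP]; rewrite eq_sym oner_eq0.
  have [H1 H0] := X01 j.
  by transitivity ((1 - p)%:E + p%:E)%E; [congr (_ + _)%E|rewrite -EFinD subrK].
by rewrite [X in (1 - X)%E](_ : _ = 1%E)// subee.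
Qed.

(** Off the null set of non-binary values, a block sums to its length exactly when all its entries
    are ones, and independence computes the latter probability. *)
Lemma prob_run d (T : measurableType d) (R : realType)
    (P : probability T R) (p : R) (X : nat -> {RV P >-> R}) i l :
  iid_bernoulli p X ->
  P [set w | \sum_(k < l) X (i + k)%N w = l%:R] = (p ^+ l)%:E.
Proof.
move=> iidX.
pose J := [fset j in iota i l]%fset.
have cJ : #|` J| = l by rewrite card_fseq undup_id ?size_iota ?iota_uniq.
have JE k : (k < l)%N -> (i + k)%N \in J.
  by move=> kl; rewrite !inE/= mem_iota leq_addr ltn_add2l.
have EJ j : j \in J -> exists2 k, (k < l)%N & j = (i + k)%N.
  rewrite !inE/= mem_iota => /andP[ij jl]; exists (j - i)%N; last by rewrite subnKC.
  by rewrite ltn_subLR.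
rewrite -cJ -(prob_all_ones J iidX) cJ.
have [N [mN N0 subN]] := negligible_not_binary iidX.
set A := mkset _; set B := \bigcap_(j in _) _.
have mA : measurable A by exact: measurable_run.
have mB : measurable B by exact: bigcap_measurableType.
apply/eqP; rewrite eq_le; apply/andP; split.
  rewrite -(measureU0 mB mN N0); apply: le_measure; rewrite ?inE//.
    exact: measurableU.
  move=> w Aw; have [Nw|nNw] := pselect (N w); [by right|left].
  have bin j : X j w = 0 \/ X j w = 1.
    by apply: contrapT => nX; apply: nNw; apply: subN; exists j.
  (* The deficits [1 - X] are nonnegative here and sum to zero, so each vanishes. *)
  have : \sum_(k < l) (1 - X (i + k)%N w) == 0.
    by rewrite sumrB Aw sumr_const card_ord subrr.
  rewrite psumr_eq0 => [/allP/= s0 j /EJ[k kl ->]|k _]; last first.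
    by case: (bin (i + k)%N) => ->; rewrite ?subr0 ?subrr.
  by have := s0 (Ordinal kl) (mem_index_enum _); rewrite subr_eq0 => /eqP.
apply: le_measure; rewrite ?inE// => w Bw.
rewrite /A/= (eq_bigr (fun=> 1)) ?sumr_const ?card_ord// => k _.
by apply: Bw; exact: JE.
Qed.

(** Union bound over the length and the starting point of a run, each ranging over [n.+1] values.
    The bound [b] is required only for lengths in [A], so that it can carry the exponential decay
    attached to [A]. *)
Lemma prob_longest_run_le d (T : measurableType d) (R : realType)
    (P : probability T R) (p : R) (X : nat -> {RV P >-> R}) n (A : set nat) b :
  iid_bernoulli p X ->
  (forall l, (l <= n)%N -> A l -> p ^+ l <= b) -> 0 <= b ->
  (P [set w | A (longest_run (fun j => X j w) n)] <= ((n.+1 ^ 2)%:R * b)%:E)%E.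
Proof.
move=> iidX Ab b0.
pose S l i := if `[< A l >]
  then [set w | \sum_(k < l) X (i + k)%N w = l%:R] else set0.
have mS l i : measurable (S l i).
  by rewrite /S; case: ifPn => // _; exact: measurable_run.
have mU l m : measurable (\big[setU/set0]_(i < m) S l i).
  exact: bigsetU_measurable.
have PS l i : (l < n.+1)%N -> (P (S l i) <= b%:E)%E.
  move=> ln; rewrite /S; case: ifPn => [/asboolP Al|_]; last by rewrite measure0.
  by rewrite (prob_run _ _ iidX) lee_fin Ab.
have PU l : (l < n.+1)%N ->
    (P (\big[setU/set0]_(i < n.+1) S l i) <= (n.+1%:R * b)%:E)%E.
  move=> ln.
  have sU : (P (\big[setU/set0]_(i < n.+1) S l i) <= \sum_(i < n.+1) P (S l i))%E.
    by apply: content_subadditive.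
  apply: le_trans sU _.
  have : (\sum_(i < n.+1) P (S l i) <= \sum_(i < n.+1) b%:E)%E.
    by apply: lee_sum => i _; exact: PS.
  move=> /le_trans; apply.
  by rewrite sumEFin sumr_const card_ord mulr_natl.
have subU : [set w | A (longest_run (fun j => X j w) n)] `<=`
    \big[setU/set0]_(l < n.+1) \big[setU/set0]_(i < n.+1) S l i.
  move=> w /= Aw; have [i iL sL] := longest_run_witness (fun j => X j w) n.
  rewrite -(bigcup_mkord _ (fun l => \big[setU/set0]_(i < n.+1) S l i)).
  exists (longest_run (fun j => X j w) n); first exact: longest_run_leq.
  rewrite -bigcup_mkord; exists i.
    by rewrite /= ltnS (leq_trans _ iL)// leq_addr.
  by rewrite /S asboolT.
have sU : (P [set w | A (longest_run (fun j => X j w) n)] <=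
    \sum_(l < n.+1) P (\big[setU/set0]_(i < n.+1) S l i))%E.
  apply: (@content_subadditive _ _ _ P _
    (fun l => \big[setU/set0]_(i < n.+1) S l i)) => //.
  exact: measurable_longest_run.
apply: le_trans sU _.
have : (\sum_(l < n.+1) P (\big[setU/set0]_(i < n.+1) S l i) <=
    \sum_(l < n.+1) (n.+1%:R * b)%:E)%E by apply: lee_sum => l _; exact: PU.
move=> /le_trans; apply.
by rewrite sumEFin sumr_const card_ord lee_fin -mulrnAl -mulrnA mulnn.
Qed.

(** * The rate function and exponential estimates *)

Lemma run_rate_itv (R : realType) (p x : R) :
  0 <= x <= 1 -> run_rate p x = (x * ln (1 / p))%:E.
Proof. by move=> /andP[x0 x1]; rewrite /run_rate ltNge x0/= x1. Qed.

Lemma run_rate_pinfty (R : realType) (p x : R) :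
  ~~ (0 <= x <= 1) -> run_rate p x = +oo%E.
Proof.
by rewrite /run_rate; case: ltP => //= x0; case: leP.
Qed.

Lemma ln_inv_gt0 (R : realType) (p : R) : 0 < p < 1 -> 0 < ln (1 / p).
Proof. by move=> /andP[p0 p1]; rewrite ln_gt0// div1r invf_gt1. Qed.

Lemma expR_ln_inv (R : realType) (p : R) (l : nat) :
  0 < p -> p ^+ l = expR (- (l%:R * ln (1 / p))).
Proof.
by move=> p0; rewrite div1r lnV ?posrE// mulrN opprK expRM_natl lnK ?posrE.
Qed.

Lemma good_run_rate (R : realType) (p : R) :
  0 < p < 1 -> good_rate_function (run_rate p).
Proof.
move=> p01; have c0 := ln_inv_gt0 p01.
(* Sublevel sets are explicit segments, which yields both compactness and lower semicontinuity. *)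
have sub (a : R) : 0 <= a ->
    [set x | (run_rate p x <= a%:E)%E] = `[0, Num.min 1 (a / ln (1 / p))]%classic.
  move=> a0; apply/seteqP; split=> x /=; rewrite in_itv/= le_min ler_pdivlMr//.
    have [x01|x01] := boolP (0 <= x <= 1); last by rewrite run_rate_pinfty.
    by rewrite run_rate_itv// lee_fin andbA x01.
  by rewrite andbA => /andP[x01]; rewrite run_rate_itv.
have ge0 x : (0 <= run_rate p x)%E.
  have [x01|x01] := boolP (0 <= x <= 1); last by rewrite run_rate_pinfty.
  by rewrite run_rate_itv// lee_fin mulr_ge0 ?(ltW c0)//; case/andP: x01.
split=> //; last by move=> a a0; rewrite sub//; exact: segment_compact.
apply/lower_semicontinuousP => a.
rewrite (_ : mkset _ = ~` [set x | (run_rate p x <= a%:E)%E]); last first.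
  apply/seteqP; split=> x /=; first by rewrite ltNge => /negP.
  by move=> /negP; rewrite -ltNge.
apply: closed_openC; have [a0|a0] := leP 0 a.
  by rewrite sub//; exact: itv_closed.
rewrite (_ : mkset _ = set0); first exact: closed0.
apply/seteqP; split=> // x /= /(le_trans (ge0 x)).
by rewrite lee_fin leNgt a0.
Qed.

(** Cubing [b * n.+1%:R <= expR (b * n%:R)] with [3 * b <= a] leaves one spare factor [n.+1], which
    beats the constant [b ^+ 3] once [n] exceeds its inverse. *)
Lemma near_sqr_le_expR (R : realType) (a : R) : 0 < a ->
  \forall n \near \oo, (n.+1 ^ 2)%:R <= expR (a * n%:R).
Proof.
move=> a0; pose b := Num.min 1 (a / 3).
have b0 : 0 < b by rewrite lt_min ltr01 divr_gt0.
have b1 : b <= 1 by rewrite ge_min lexx.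
have ba : 3 * b <= a by rewrite -ler_pdivlMl// mulrC ge_min lexx orbT.
near=> n.
have bn : b * n.+1%:R <= expR (b * n%:R).
  apply: le_trans (expR_ge1Dx _); rewrite -natr1 mulrDr mulr1 addrC lerD2r.
  exact: b1.
apply: (@le_trans _ _ ((b * n.+1%:R) ^+ 3)); last first.
  apply: (@le_trans _ _ (expR (b * n%:R) ^+ 3)).
    by rewrite lerXn2r// nnegrE ?expR_ge0// mulr_ge0// ltW.
  by rewrite -expRM_natl ler_expR mulrA ler_wpM2r.
rewrite exprMn natrX exprS mulrA ler_peMl// -ler_pdivrMl ?exprn_gt0// mulr1.
apply: (@le_trans _ _ n%:R); last by rewrite ler_nat.
by near: n; exact: nbhs_infty_ger.
Unshelve. all: by end_near. Qed.

Lemma scaled_lne_le (R : realType) (a : R) (x : \bar R) (n : nat) :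
  (0 < n)%N -> (x <= (expR (a * n%:R))%:E)%E ->
  ((n%:R^-1)%:E * lne x <= a%:E)%E.
Proof.
move=> n0 xa; rewrite lee_pdivrMl ?ltr0n// -EFinM mulrC.
(* At probability zero the logarithm is [-oo] and the bound is trivial. *)
have [x0|x0] := leP x 0%E; first by rewrite le0_lneNy// leNye.
rewrite -(expRK (a * n%:R)) -lne_EFin ?expR_gt0// lee_lne//.
  by rewrite in_itv/= ltW//= leey.
by rewrite in_itv/= lee_fin expR_ge0 leey.
Qed.

Lemma le_scaled_lne (R : realType) (a : R) (x : \bar R) (n : nat) :
  (0 < n)%N -> ((expR (a * n%:R))%:E <= x)%E ->
  (a%:E <= (n%:R^-1)%:E * lne x)%E.
Proof.
move=> n0 ax; rewrite lee_pdivlMl ?ltr0n// -EFinM mulrC.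
have x0 : (0 <= x)%E by apply: le_trans ax; rewrite lee_fin expR_ge0.
rewrite -(expRK (a * n%:R)) -lne_EFin ?expR_gt0// lee_lne//.
  by rewrite in_itv/= lee_fin expR_ge0 leey.
by rewrite in_itv/= x0 leey.
Qed.

(** * The two large deviation bounds *)

Lemma longest_run_ldp_upper d (T : measurableType d) (R : realType)
    (P : probability T R) (p : R) (X : nat -> {RV P >-> R}) (F : set R) :
  0 < p < 1 -> iid_bernoulli p X ->
  (limn_esup (fun n => (n%:R^-1)%:E *
     lne (P [set w | F ((longest_run (fun j => X j w) n)%:R / n%:R)]%R)) <=
   - ereal_inf (run_rate p @` F))%E.
Proof.
move=> p01 iidX; have p0 : 0 < p by case/andP: p01.
set u := (X in limn_esup X).
(* Real minorants [a] replace the infimum, which is [+oo] when [F] misses the unit interval. The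
   slack [e] then absorbs the factor [(n + 1)^2]. *)
have key (a : R) : (a%:E <= ereal_inf (run_rate p @` F))%E ->
    (limn_esup u <= - a%:E)%E.
  move=> aF; apply/lee_addgt0Pr => e e0; apply: limn_esup_le.
  near=> n; have n0 : (0 < n)%N by near: n; exact: nbhs_infty_gt.
  have n0' : 0 < n%:R :> R by rewrite ltr0n.
  rewrite /u -EFinN -EFinD; apply: scaled_lne_le => //.
  have := @prob_longest_run_le _ _ _ P p X n [set l | F (l%:R / n%:R)]
    (expR (- (a * n%:R))) iidX.
  move=> H; apply: le_trans (H _ (expR_ge0 _)) _ => {H}.
    move=> l ln /= Fl; rewrite expR_ln_inv// ler_expR lerN2 -ler_pdivlMr// mulrAC.
    rewrite -lee_fin -run_rate_itv.
      by apply: (le_trans aF); apply: ereal_inf_lbound; exists (l%:R / n%:R).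
    by rewrite divr_ge0// ler_pdivrMr// mul1r ler_nat.
  rewrite lee_fin mulrDl mulNr addrC expRD ler_wpM2r ?expR_ge0//.
  by near: n; exact: near_sqr_le_expR.
rewrite leeNr; set m := ereal_inf _ in key *.
have m0 : (0 <= m)%E.
  apply: le_ereal_inf_tmp => _ [x _ <-]; by case: (good_run_rate p01).
case: m m0 key => [r _|_|//] key; first by rewrite leeNr; exact: key.
(* With infinite infimum every real [a] is admissible, so the limit superior is [-oo]. *)
by rewrite leye_eq; apply/eqP/eqyP => a _; rewrite leeNr; apply: key; rewrite leey.
Unshelve. all: by end_near. Qed.

Lemma longest_run_ldp_lower d (T : measurableType d) (R : realType)
    (P : probability T R) (p : R) (X : nat -> {RV P >-> R}) (O : set R) :
  0 < p < 1 -> iid_bernoulli p X -> open O ->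
  (- ereal_inf (run_rate p @` O) <=
   limn_einf (fun n => (n%:R^-1)%:E *
     lne (P [set w | O ((longest_run (fun j => X j w) n)%:R / n%:R)]%R)))%E.
Proof.
move=> p01 iidX openO; have p0 : 0 < p by case/andP: p01.
have c0 := ln_inv_gt0 p01; set c := ln (1 / p) in c0.
rewrite leeNl; apply: le_ereal_inf_tmp => _ [x Ox <-]; rewrite leeNl.
have [x01|x01] := boolP (0 <= x <= 1); last by rewrite run_rate_pinfty// leNye.
rewrite run_rate_itv// -/c -EFinN.
(* The slack [e] will pay for the factor 1/2 in the final bound. *)
apply/lee_addgt0Pr => e e0; rewrite -leeBlDr// -EFinN -EFinD.
have /nbhs_ballP[r /= r0 xrO] := open_nbhs_nbhs (conj openO Ox).
have cr0 : 0 < c * r / 2 by rewrite divr_gt0// mulr_gt0.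
apply: le_limn_einf; near=> n.
have n0 : (0 < n)%N by near: n; exact: nbhs_infty_gt.
have n0' : 0 < n%:R :> R by rewrite ltr0n.
(* Rounding [x * n] down to [l] loses less than 1, hence less than [r * n]. *)
have nr : 1 < r * n%:R.
  by rewrite mulrC -ltr_pdivrMr// mul1r; near: n; exact: nbhs_infty_gtr.
have half (a : R) : (n.+1 ^ 2)%:R <= expR (a * n%:R) -> expR (- (a * n%:R)) <= 2^-1.
  move=> na; rewrite expRN lef_pV2 ?posrE ?expR_gt0//; apply: le_trans na.
  by rewrite ler_nat (@leq_trans (2 ^ 2))// leq_exp2r.
(* Overshooting by [r] costs [expR (- (c * r * n))]: one half of this exponent absorbs the union
   bound factor, the other supplies 1/2. *)
have small : (n.+1 ^ 2)%:R <= expR (c * r / 2 * n%:R).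
  by near: n; exact: near_sqr_le_expR.
have eh : expR (- (e * n%:R)) <= 2^-1.
  by apply: half; near: n; exact: near_sqr_le_expR.
pose l := Num.truncn (x * n%:R).
have xn0 : 0 <= x * n%:R by rewrite mulr_ge0//; case/andP: x01.
have /andP[lx xl] := truncn_itv xn0; rewrite -/l in lx xl.
have ln : (l <= n)%N.
  by rewrite -(ler_nat R) (le_trans lx)// ler_piMl//; case/andP: x01.
apply: le_scaled_lne => //.
set L := fun w => longest_run (fun j => X j w) n.
set B := [set w | O _].
(* Only overshooting must be excluded: a run on the first [l] trials already rules out
   [L / n <= x - r]. *)
pose far k := x + r <= k%:R / n%:R.
have mB : measurable B.
  exact: (measurable_longest_run X n [set k | O (k%:R / n%:R)]).
have mfar : measurable [set w | far (L w)].
  exact: (measurable_longest_run X n far).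
have sub : [set w | \sum_(k < l) X (0 + k)%N w = l%:R] `<=`
    B `|` [set w | far (L w)].
  move=> w /= sl; have lL : (l <= L w)%N by exact: leq_longest_run sl.
  have [f|nf] := boolP (far (L w)); [by right|left].
  apply: xrO; rewrite /ball/= distrC ltr_norml; apply/andP; split; last first.
    by rewrite ltrBlDl ltNge.
  rewrite ltrBrDl ltr_pdivlMr// mulrBl.
  have : l%:R <= (L w)%:R :> R by rewrite ler_nat.
  move: xl; rewrite -natr1; lra.
have farle : (P [set w | far (L w)] <= (expR (- (c * x * n%:R)) / 2)%:E)%E.
  have := @prob_longest_run_le _ _ _ P p X n far
    (expR (- (c * (x + r) * n%:R))) iidX.
  move=> H; apply: le_trans (H _ (expR_ge0 _)) _ => {H}.
    move=> k kn; rewrite /far ler_pdivlMr// => xk.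
    by rewrite expR_ln_inv// ler_expR lerN2 -/c -mulrA [_ * c]mulrC ler_pM2l.
  rewrite lee_fin; apply: le_trans (ler_wpM2r (expR_ge0 _) small) _.
  rewrite -expRD; apply: le_trans (ler_wpM2l (expR_ge0 _) (half _ small)).
  by rewrite -expRD ler_expR; lra.
have main : ((expR (- (c * x * n%:R)))%:E <= P B + P [set w | far (L w)])%E.
  apply: le_trans (measureU2 P mB mfar).
  apply: (@le_trans _ _ (P [set w | \sum_(k < l) X (0 + k)%N w = l%:R])).
    rewrite (prob_run _ _ iidX) lee_fin expR_ln_inv// ler_expR lerN2 -/c.
    by rewrite -mulrA [_ * c]mulrC ler_pM2l.
  apply: le_measure; rewrite ?inE//; first exact: measurable_run.
  exact: measurableU.
(* Subtracting the overshoot probability, at most half of the total, leaves the other half for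
   [B]. *)
have : ((expR (- (c * x * n%:R)) / 2)%:E <= P B)%E.
  have := le_trans main (leeD2l (P B) farle).
  rewrite -leeBlDr// -EFinN -EFinD; apply: le_trans.
  by rewrite lee_fin; lra.
apply: le_trans; rewrite lee_fin mulrDl !mulNr expRD (mulrC x c).
by rewrite ler_wpM2l ?expR_ge0.
Unshelve. all: by end_near. Qed.

Theorem corollary2 (d : measure_display) (T : measurableType d) (R : realType)
    (P : probability T R) (p : R) (X : nat -> {RV P >-> R}) :
  0 < p < 1 ->
  iid_bernoulli p X ->
  let L n w := longest_run (fun j => X j w) n in
  [/\ good_rate_function (run_rate p),
      (forall O : set R, open O ->
         (- ereal_inf (run_rate p @` O) <=
          limn_einf (fun n => (n%:R^-1)%:E *
            lne (P [set w | O ((L n w)%:R / n%:R)]%R)))%E) &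
      (forall F : set R, closed F ->
         (limn_esup (fun n => (n%:R^-1)%:E *
            lne (P [set w | F ((L n w)%:R / n%:R)]%R)) <=
          - ereal_inf (run_rate p @` F))%E)].
Proof.
move=> p01 iidX L; split.
- exact: good_run_rate.
- by move=> O openO; exact: longest_run_ldp_lower.
- by move=> F _; exact: longest_run_ldp_upper.
Qed.
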